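(* Let $a,b,p,q\in\mathbb{Z}$ and let $(W_n)_{n\ge0}$ be the Horadam sequence defined by $W_0=a$, $W_1=b$ and $W_n=pW_{n-1}+qW_{n-2}$ for $n\ge2$. Let $(V_n)_{n\ge0}$ be the generalized Lucas sequence defined by $V_0=2$, $V_1=p$ and $V_n=pV_{n-1}+qV_{n-2}$ for $n\ge 2$. Then for every positive integer $i$ and every integer $n\ge2$, \[ W_{ni+i}=V_{i}^{\,n-1}W_{2i}-(-q)^{i}\sum_{j=1}^{n-1}V_{i}^{\,n-1-j}W_{ij}. \]
   Context: $W_n=W_n(a,b;p,q)$ denotes the Horadam sequence with the given initial values and recurrence; $V_n$ is the Horadam sequence $W_n(2,p;p,q)$ (generalized Lucas numbers). *)

(* Defs.v *)
From mathcomp Require Import all_boot all_order all_algebra.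

Set Implicit Arguments.
Unset Strict Implicit.
Unset Printing Implicit Defensive.

Import Order.TTheory GRing.Theory Num.Theory.
Local Open Scope ring_scope.

(* In the notation W_n(a,b;p,q): a, b are the initial values, and lucasV is V_n = W_n(2,p;p,q). *)
Fixpoint horadam (a b p q : int) (n : nat) : int :=
  match n with
  | 0%N => a
  | 1%N => b
  | (m.+1 as k).+1 => p * horadam a b p q k + q * horadam a b p q m
  end.

Definition lucasV (p q : int) (n : nat) : int := horadam 2 p p q n.

(* Main.v *)
(** The index-[i] step recurrence [W_(m+2i) = V_i W_(m+i) - (-q)^i W_m], taken at
    [m = ni], is a first-order linear recurrence for [W_(ni+i)] with coefficient
    [V_i]; unrolling it down to [W_(2i)] gives the sum. *)
Require Import Defs.
From mathcomp Require Import all_boot all_order all_algebra.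
From mathcomp Require Import ring.

Import Order.TTheory GRing.Theory Num.Theory.
Local Open Scope ring_scope.

Lemma horadamSS (a b p q : int) (n : nat) :
  horadam a b p q n.+2 = p * horadam a b p q n.+1 + q * horadam a b p q n.
Proof. by []. Qed.

Lemma horadam_lucasV (a b p q : int) (i m : nat) :
  horadam a b p q (m + i + i)%N =
  lucasV p q i * horadam a b p q (m + i)%N - (- q) ^+ i * horadam a b p q m.
Proof.
(* For fixed [s = m + i], both [W_(s+i) + (-q)^i W_(s-i)] and [V_i W_s] satisfy the
   recurrence of [V] in [i]; fixing [s] makes [m] vary in the induction. *)
suff H : forall m, horadam a b p q (m + i + i)%N =
    lucasV p q i * horadam a b p q (m + i)%N - (- q) ^+ i * horadam a b p q m
  /\ horadam a b p q (m + i.+1 + i.+1)%N =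
    lucasV p q i.+1 * horadam a b p q (m + i.+1)%N
    - (- q) ^+ i.+1 * horadam a b p q m by case: (H m).
elim: i {m} => [|i IHi] m.
  rewrite !addn0 !addn1 horadamSS /lucasV /=.
  by split; ring.
have [_ IH1] := IHi m; split=> //.
(* Both instances keep the centre [s = m + i.+2]: starting points [m.+2] and [m.+1] go with [i] and
   [i.+1]. *)
have [IH0 _] := IHi m.+2; have [_ {}IH1] := IHi m.+1.
move: IH0 IH1; rewrite !addnS !addSn !exprS /lucasV => IH0 IH1.
rewrite [LHS]horadamSS [horadam 2 _ _ _ _]horadamSS.
rewrite mulrDl -!mulrA.
move/eqP: IH0; rewrite eq_sym subr_eq => /eqP ->.
move/eqP: IH1; rewrite eq_sym subr_eq => /eqP ->.
rewrite [horadam a b p q m.+2]horadamSS.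
by ring.
Qed.

Theorem theorem2 (a b p q : int) (i n : nat) (hi : (0 < i)%N) (hn : (2 <= n)%N) :
  horadam a b p q (n * i + i)%N =
  lucasV p q i ^+ (n - 1)%N * horadam a b p q (2 * i)%N
  - (- q) ^+ i *
    \sum_(1 <= j < n) lucasV p q i ^+ (n - 1 - j)%N * horadam a b p q (i * j)%N.
Proof.
(* After this shift the induction starts at index 1, where the sum is empty. *)
case: n hn => // n _; rewrite !subn1 succnK.
elim: n => [|n IHn].
  by rewrite big_geq // expr0 mul1r mulr0 subr0 mul1n addnn mul2n.
(* The last term of the index-[i] step is the new summand [j = n.+1], with exponent 0; the older
   summands each gain a factor [lucasV p q i]. *)
rewrite mulSnr horadam_lucasV IHn [in RHS]big_nat_recr //= subnn.
rewrite expr0 mul1r (mulnC i).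
have -> : \sum_(1 <= j < n.+1) lucasV p q i ^+ (n.+1 - j) * horadam a b p q (i * j)
   = lucasV p q i
     * \sum_(1 <= j < n.+1) lucasV p q i ^+ (n - j) * horadam a b p q (i * j).
  rewrite mulr_sumr; apply: eq_big_nat => j /andP[_ ltjn].
  by rewrite subSn // exprS mulrA.
by rewrite exprS; ring.
Qed.
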